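(* Let $X$ and $Y$ be locally compact Hausdorff spaces and let $F:X\to Y$ be a continuous map. Then $F$ is injective and proper if and only if $F^*(C_0(Y))=C_0(X)$.
   Context: $C_0(X)$ denotes the $C^*$-algebra of complex-valued continuous functions on $X$ vanishing at infinity (for every $\varepsilon>0$ there is a compact $K\subseteq X$ with $|f(x)|<\varepsilon$ for all $x\notin K$). $F^*(f):=f\circ F$, so a priori $F^*$ maps $C_0(Y)$ into bounded continuous functions on $X$. A continuous map $F:X\to Y$ is called proper if $F\times\mathrm{id}:X\times Z\to Y\times Z$ is closed for every topological space $Z$; for $X$ Hausdorff and $Y$ locally compact Hausdorff this is equivalent to $F^{-1}(K)$ being compact for every compact $K\subseteq Y$. *)

(* Defs.v *)
From HB Require Import structures.
From mathcomp Require Import all_boot all_order all_algebra.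
From mathcomp Require Import all_classical all_reals all_analysis.
From mathcomp Require Import complex.

Set Implicit Arguments.
Unset Strict Implicit.
Unset Printing Implicit Defensive.

Import Order.TTheory GRing.Theory Num.Theory.
Import numFieldNormedType.Exports.

Local Open Scope classical_set_scope.
Local Open Scope ring_scope.
Local Open Scope complex_scope.

(* [R[i]^o] is [R[i]] as a normed space over itself: [R[i]] alone carries no
   inferable topology.  Its norm takes values in [R[i]] (nonnegative reals),
   hence the cast [e%:C]. *)
Definition vanishes_at_infinity (R : realType) (X : topologicalType)
    (f : X -> R[i]^o) : Prop :=
  forall e : R, 0 < e ->
    exists2 K : set X, compact K & forall x, ~ K x -> `|f x| < e%:C.

Definition C0 (R : realType) (X : topologicalType) : set (X -> R[i]^o) :=
  [set f | continuous f /\ vanishes_at_infinity f].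

Arguments C0 R X _ : clear implicits.

Definition pullback (X Y T : Type) (F : X -> Y) (f : Y -> T) : X -> T :=
  f \o F.

Definition closed_map (X Y : topologicalType) (f : X -> Y) : Prop :=
  forall A : set X, closed A -> closed (f @` A).

Definition times_id (X Y Z : Type) (F : X -> Y) (p : X * Z) : Y * Z :=
  (F p.1, p.2).

Definition proper_map (X Y : topologicalType) (F : X -> Y) : Prop :=
  continuous F /\
  forall Z : topologicalType, closed_map (times_id F : X * Z -> Y * Z).

(* Main.v *)
Require Import Defs.
From mathcomp Require Import all_boot all_order all_algebra.
From mathcomp Require Import all_classical all_reals all_analysis.
From mathcomp Require Import complex.
Import numFieldNormedType.Exports.
Local Open Scope classical_set_scope.

(** A continuous function on a locally compact Hausdorff space [X] vanishes at
    infinity exactly when it extends by [0] to a continuous function on the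
    one-point compactification [X^+], a compact Hausdorff (hence normal) space
    ([C0_continuousP]).  Proper maps are those pulling compact sets back to
    compact sets ([proper_compact_preimage], [compact_preimage_proper]), and
    such a map extends to a continuous map [F^+ : X^+ -> Y^+] sending
    infinity to infinity ([omap_continuous]).

    If [F] is injective and proper, then composing with [F^+] shows that [F^*]
    maps [C_0(Y)] into [C_0(X)].  It is onto because [F^+], a continuous
    injection of a compact space into a Hausdorff one, is a closed embedding:
    the real and imaginary parts of a function on [X^+] extend along it by
    Tietze's theorem ([pullback_C0_surjective]).

    Conversely, [C_0] contains enough Urysohn functions ([C0_urysohn]).  If
    [F^*] is onto, then a function of [C_0(X)] separating [x] from [x'] factors
    through [F], so [F x <> F x'].  If [F^*] lands in [C_0(X)], take [h] in
    [C_0(Y)] equal to [1] on a compact [K]: since [h \o F] is [1] on the closed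
    set [F @^-1` K] and vanishes at infinity, this preimage lies in a compact
    set. *)

Set Implicit Arguments.
Unset Strict Implicit.
Unset Printing Implicit Defensive.

Import Order.TTheory GRing.Theory Num.Theory.
Local Open Scope ring_scope.
Local Open Scope complex_scope.

Local Notation opc := one_point_compactification.

(** * Proper maps and compact preimages *)

Lemma closed_graph (X Y : topologicalType) (f : X -> Y) :
  hausdorff_space Y -> continuous f -> closed [set p : X * Y | f p.1 = p.2].
Proof.
move=> hY cf [x y] clp; apply: hY => U V Ux Vy.
have /clp[[a b] [/= <- [/= Ua Vb]]] : nbhs (x, y) ((f @^-1` U) `*` V).
  by exists (f @^-1` U, V) => //; split => //; exact: cf.
by exists (f a).
Qed.

(** [Some] embeds [X] in [opc X], so if [Some x] is a cluster point of the image
    of a filter under [Some], then [x] is a cluster point of the filter. *)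
Lemma compact_preimage_Some (X : topologicalType) (A : set X) :
  compact (Some @` A : set (opc X)) -> compact A.
Proof.
move=> cA F FF FA.
have FSA : ((Some : X -> opc X) @ F) (Some @` A).
  by rewrite /fmap /=; apply: filterS FA; exact: preimage_image.
have [_ [[x Ax <-] clx]] := cA _ _ FSA.
exists x; split => // B C FB Cx.
have [||_ [[b Bb <-] [c Cc [cb]]]] := clx (Some @` B) (Some @` C).
- by rewrite /fmap /=; apply: filterS FB; exact: preimage_image.
- exact: one_point_compactification_some_nbhs.
by exists b; split => //; rewrite -cb.
Qed.

(** Universal closedness is applied with [Z] the one-point compactification of
    [X].  The graph of [Some] is closed in [X * opc X], so its image
    [{(F x, Some x)}] is closed in [Y * opc X]; the part of it above [K] is
    closed in the compact set [K * opc X], and its second projection is the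
    copy of [F @^-1` K] in [opc X]. *)
Lemma proper_compact_preimage (X Y : topologicalType) (F : X -> Y) :
  locally_compact [set: X] -> hausdorff_space X -> proper_map F ->
  forall K, compact K -> compact (F @^-1` K).
Proof.
move=> lcX hX [cF clF] K cK; apply: compact_preimage_Some.
pose G : set (X * opc X) := [set p | Some p.1 = p.2].
have clG : closed G.
  apply: closed_graph; first exact: one_point_compactification_hausdorff.
  exact: one_point_compactification_some_continuous.
have cKG := compact_closedI
  (compact_setX cK one_point_compactification_compact) (clF _ _ clG).
suff -> : Some @` (F @^-1` K) =
    snd @` ((K `*` [set: opc X]) `&` (times_id F @` G)).
  apply: continuous_compact cKG; apply: continuous_subspaceT => p.
  exact: cvg_snd.
apply/seteqP; split=> [_ [x Kx <-]|_ [p [[Kp _] [[x z] /= xz pE]] <-]].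
- by exists (F x, Some x) => //; split => //; exists (x, Some x).
- by exists x; rewrite -?pE//; move: Kp; rewrite -pE.
Qed.

(** Let [(y, z)] be in the closure of the image of a closed set [A].  The points
    of [A] that are sent close to [(y, z)] form a filter base, whose first
    projection eventually lies in the preimage of a compact neighbourhood of
    [y].  A cluster point [x] of this projection satisfies [F x = y], as [Y] is
    Hausdorff, and [(x, z)] is in the closure of [A]. *)
Lemma compact_preimage_proper (X Y : topologicalType) (F : X -> Y) :
  locally_compact [set: Y] -> hausdorff_space Y -> continuous F ->
  (forall K, compact K -> compact (F @^-1` K)) -> proper_map F.
Proof.
move=> lcY hY cF cptF; split=> // Z A clA [y z] clyz.
have [K + [cK _]] := lcY y I; rewrite withinET => Ky.
pose N := filter_from (nbhs ((y, z) : Y * Z))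
  (fun W => A `&` times_id F @^-1` W).
pose G := fst @ N.
have NF : ProperFilter N.
  apply: filter_from_proper; first apply: filter_from_filter.
  - by exists setT; exact: filterT.
  - move=> V W Vn Wn; exists (V `&` W); first exact: filterI.
    by move=> p [Ap [Vp Wp]].
  - by move=> W /clyz[_ [[p Ap <-] Wp]]; exists p.
have [x [Kx clx]] : F @^-1` K `&` cluster G !=set0.
  apply: (cptF K cK G); exists (K `*` setT).
    by exists (K, setT) => //; split => //; exact: filterT.
  by move=> p [_ []].
have Fxy : F x = y.
  apply: hY => U V Ux Vy.
  have [| |a [Va Ua]] := clx (F @^-1` V) (F @^-1` U).
  - exists (V `*` setT); last by move=> p [_ []].
    by exists (V, setT) => //; split => //; exact: filterT.
  - exact: cF.
  by exists (F a).
exists (x, z); last by rewrite /times_id /= Fxy.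
apply: clA => W [[U V] [/= Ux Vz] UVW].
have [|a [[b [Aab Vb]] Ua]] := clx [set a | exists b, A (a, b) /\ V b] U _ Ux.
  exists (setT `*` V).
    by exists (setT, V) => //; split => //; exact: filterT.
  by move=> [a b] [Aab [_ Vb]]; exists b.
by exists (a, b); split => //; apply: UVW.
Qed.

(** * Functions vanishing at infinity and the one-point compactification *)

Lemma one_point_normal (X : topologicalType) :
  locally_compact [set: X] -> hausdorff_space X -> normal_space (opc X).
Proof.
move=> lcX hX; apply: compact_normal one_point_compactification_compact.
exact: one_point_compactification_hausdorff.
Qed.

(** Continuity at infinity is where compactness of preimages is needed: the
    complement of a compact [K] pulls back to the complement of [F @^-1` K]. *)
Lemma omap_continuous (X Y : topologicalType) (F : X -> Y) :
  hausdorff_space X -> continuous F ->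
  (forall K, compact K -> compact (F @^-1` K)) ->
  continuous (omap F : opc X -> opc Y).
Proof.
move=> hX cF cptF [x|] A; first exact: cF.
move=> [K [cK _] KA]; exists (F @^-1` K).
  by split; [|apply: compact_closed => //]; exact: cptF.
move=> _ [[x nKx <-]|->]; apply: KA; last by right.
by left; exists (F x).
Qed.

(** The basic neighbourhoods of infinity are the complements of the closed
    compact sets, so continuity at [None] with value [0] is the vanishing
    condition; in a Hausdorff space compact sets are automatically closed. *)
Lemma C0_continuousP (R : realType) (X : topologicalType) (f : X -> R[i]^o) :
  hausdorff_space X -> C0 R X f <-> continuous (oapp f 0 : opc X -> R[i]^o).
Proof.
move=> hX; split=> [[cf f0] [x|]|cf]; first exact: cf.
- apply/(@cvgr0Pnorm_lt _ _ _ (nbhs (None : opc X))) => e e0.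
  (* the norm of R[i] is R[i]-valued, so the radius e is a priori complex *)
  have eE : (complex.Re e)%:C = e by rewrite RRe_real// gtr0_real.
  have [|K cK Kf] := f0 (complex.Re e); first by rewrite -ltcR eE.
  exists K; first by split => //; exact: compact_closed.
  by move=> _ [[x nKx <-]|->] /=; rewrite ?normr0// -eE; exact: Kf.
- split=> [x|e e0]; first exact: (cf (Some x)).
  have /(@cvgr0Pnorm_lt _ _ _ (nbhs (None : opc X)))/(_ e%:C) := cf None.
  rewrite ltcR => /(_ e0) [K [cK _] KP].
  by exists K => // x nKx; apply: (KP (Some x)); left; exists x.
Qed.

(** * The real and imaginary parts as continuous maps *)

Lemma continuous_Re (R : realType) : continuous (@complex.Re R : R[i]^o -> R^o).
Proof.
move=> z; apply/(@cvgrPdist_lt _ _ _ (nbhs (z : R[i]^o))) => e e0; near=> w.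
rewrite -ltcR -raddfB (le_lt_trans (normc_ge_Re _))//.
near: w; apply: (@cvgr_dist_lt _ R[i]^o _ (nbhs (z : R[i]^o)) _ id z).
  exact: cvg_id.
by rewrite ltcR.
Unshelve. all: by end_near. Qed.

Lemma continuous_real_complex (R : realType) :
  continuous (real_complex R : R^o -> R[i]^o).
Proof.
move=> z; apply/cvgrPdist_lt => e e0.
have eE : (complex.Re e)%:C = e by rewrite RRe_real// gtr0_real.
near=> w; rewrite -rmorphB /= normc_def /= expr0n addr0 sqrtr_sqr -eE ltcR.
near: w; apply: (@cvgr_dist_lt _ R^o _ (nbhs (z : R^o)) _ id z).
  exact: cvg_id.
by rewrite -ltcR eE.
Unshelve. all: by end_near. Qed.

Lemma continuous_Im (R : realType) : continuous (@complex.Im R : R[i]^o -> R^o).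
Proof.
have -> : @complex.Im R = (fun z => complex.Re (- 'i * z)).
  by apply/funext => -[a b]; simpc.
move=> z; apply: continuous_comp; last exact: continuous_Re.
by apply: (@continuousM R[i]); [exact: cst_continuous|exact: cvg_id].
Qed.

(** * Extension and separation by continuous functions *)

(** [F] sends closed sets to compact, hence closed, sets, so it is a
    homeomorphism onto its closed range; Tietze's theorem applies to
    [g \o F^-1] on that range, which is bounded since [X] is compact. *)
Lemma continuous_extension_along_injection (R : realType)
    (X Y : topologicalType) (F : X -> Y) (g : X -> R^o) :
  compact [set: X] -> hausdorff_space Y -> normal_space Y ->
  continuous F -> injective F -> continuous g ->
  exists2 h : Y -> R^o, continuous h & h \o F = g.
Proof.
move=> cX hY nY cF iF cg.
(* g \o F^-1, extended by 0 off the range of F *)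
pose g' y : R^o :=
  if pselect (exists x, F x = y) is left e then g (projT1 (cid e)) else 0.
have g'F x : g' (F x) = g x.
  rewrite /g'; case: pselect => [e|[]]; last by exists x.
  by congr g; apply: iF; exact: (projT2 (cid e)).
have clim A : closed A -> closed (F @` A).
  move=> clA; apply: compact_closed => //; apply: continuous_compact.
    exact: continuous_subspaceT.
  by rewrite -[A]setTI; exact: compact_closedI.
have cg' : {within range F, continuous g'}.
  apply/continuous_closedP => C clC; apply/closed_subspaceP.
  exists (F @` (g @^-1` C)).
    by apply: clim; apply: preimage_closed clC => x _; exact: cg.
  apply/seteqP; split=> [_ [[x Cx <-] _]|y [/= Cy [x _ xy]]].
    by split; [rewrite -[_ (F x)]/(C (g' (F x))) g'F|exists x].
  move: Cy; rewrite -xy -[X in X -> _]/(C (g' (F x))) g'F => Cx.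
  by split; exists x.
have [M [Mr gM]] : bounded_set (range g).
  apply: compact_bounded; apply: continuous_compact => //.
  exact: continuous_subspaceT.
pose M' := Num.max 1 (M + 1).
have M'0 : 0 < M' by rewrite lt_max ltr01.
have [_ [x _ <-]|h [hg ch _]] :=
    continuous_bounded_extension nY (clim _ closedT) M'0 cg'.
  rewrite g'F; apply: gM; last by exists x.
  by rewrite lt_max ltrDl ltr01 orbT.
exists h => //; apply/funext => x /=.
by rewrite -g'F -hg// inE; exists x.
Qed.

(** Urysohn's lemma in the one-point compactification; the point at infinity is
    put on the side where the function is [0], so that its restriction to [X]
    is in [C_0]. *)
Lemma C0_urysohn (R : realType) (X : topologicalType) (K B : set X) :
  locally_compact [set: X] -> hausdorff_space X ->
  compact K -> closed B -> K `&` B = set0 ->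
  exists2 f, C0 R X f &
    (forall x, K x -> f x = 1) /\ (forall x, B x -> f x = 0).
Proof.
move=> lcX hX cK clB KB0.
have clK' : closed (Some @` K : set (opc X)).
  apply: compact_closed; first exact: one_point_compactification_hausdorff.
  apply: continuous_compact cK; apply: continuous_subspaceT.
  exact: one_point_compactification_some_continuous.
(* the copy of B together with the point at infinity *)
have clB' : closed (~` (Some @` ~` B) : set (opc X)).
  apply: open_closedC; apply: one_point_compactification_open_some.
  exact: closed_openC.
have BK0 : ~` (Some @` ~` B) `&` Some @` K = set0 :> set (opc X).
  apply/seteqP; split => // y [nBy [x Kx xy]]; apply: nBy; exists x => // Bx.
  by have : set0 x by rewrite -KB0.
have [h [ch hB hK _]] :=
  urysohn_ext_itv (one_point_normal lcX hX) clB' clK' BK0 (@ltr01 R).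
exists (fun x => (h (Some x))%:C); last split=> [x Kx|x Bx].
- apply/C0_continuousP => //.
  have -> : oapp (fun x => (h (Some x))%:C) 0 = real_complex R \o h.
    apply/funext => -[x//|] /=; rewrite [h None]hB//.
    by exists None => // -[].
  move=> x; apply: continuous_comp; first exact: ch.
  exact: continuous_real_complex.
- by rewrite [h _]hK//; exists (Some x) => //; exists x.
- rewrite [h _]hB//; exists (Some x) => // -[y nBy [yx]].
  by apply: nBy; rewrite yx.
Qed.

(** The real and imaginary parts of the extension of [g] to [opc X] are extended
    to [opc Y] along [omap F]; the result vanishes at [None] because [omap F]
    sends [None] to [None], so it restricts to a function of [C_0(Y)]. *)
Lemma pullback_C0_surjective (R : realType) (X Y : topologicalType)
    (F : X -> Y) :
  hausdorff_space X -> locally_compact [set: Y] -> hausdorff_space Y ->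
  continuous F -> injective F ->
  (forall K, compact K -> compact (F @^-1` K)) ->
  C0 R X `<=` pullback F @` C0 R Y.
Proof.
move=> hX lcY hY cF iF cptF g /C0_continuousP-/(_ hX) cg.
have ext (p : R[i]^o -> R^o) : continuous p ->
    exists2 h : opc Y -> R^o, continuous h & h \o omap F = p \o oapp g 0.
  move=> cp; apply: (@continuous_extension_along_injection R (opc X) (opc Y)
    (omap F) (p \o oapp g 0)).
  - exact: one_point_compactification_compact.
  - exact: one_point_compactification_hausdorff.
  - exact: one_point_normal.
  - exact: omap_continuous.
  - by apply: inj_omap.
  - by move=> x; apply: continuous_comp; [exact: cg|exact: cp].
have [a ca aE] := ext _ (@continuous_Re R).
have [b cb bE] := ext _ (@continuous_Im R).
pose h : opc Y -> R[i]^o := fun y => (a y)%:C + 'i * (b y)%:C.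
have hE x : h (omap F x) = oapp g 0 x.
  rewrite /h -[a _]/((a \o omap F) x) -[b _]/((b \o omap F) x) aE bE.
  by rewrite -complexE.
exists (h \o Some); last by apply/funext => x; exact: (hE (Some x)).
apply/C0_continuousP => //.
have -> : oapp (h \o Some) 0 = h.
  by apply/funext => -[y//|] /=; rewrite -[LHS](hE None).
have cC (k : opc Y -> R^o) : continuous k ->
    continuous (real_complex R \o k : opc Y -> R[i]^o).
  move=> ck x; apply: continuous_comp; first exact: ck.
  exact: continuous_real_complex.
move=> y; rewrite /continuous_at /h; apply: (@cvgD _ R[i]^o _ (nbhs y)).
  exact: cC.
by apply: (@cvgM R[i] _ (nbhs y)); [exact: cvg_cst|exact: cC].
Qed.

(** * Characterization of proper injections *)

Theorem theorem1p12 (R : realType) (X Y : topologicalType)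
  (lcX : locally_compact [set: X]) (hsX : hausdorff_space X)
  (lcY : locally_compact [set: Y]) (hsY : hausdorff_space Y)
  (F : X -> Y) (ctsF : continuous F) :
  injective F /\ proper_map F <-> pullback F @` (C0 R Y) = C0 R X.
Proof.
split=> [[iF pF]|FC0].
  have cptF := @proper_compact_preimage _ _ _ lcX hsX pF.
  apply/seteqP; split; last exact: pullback_C0_surjective.
  move=> _ [f /C0_continuousP-/(_ hsY) cf <-]; apply/C0_continuousP => //.
  have -> : oapp (pullback F f) 0%R = oapp f 0%R \o omap F.
    by apply/funext => -[].
  have cF x := omap_continuous hsX ctsF cptF x.
  by move=> x; exact: (@continuous_comp (opc X) (opc Y) _ _ _ x (cF x) (cf _)).
split.
  move=> x x' Fxx'; apply: contrapT => xx'.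
  have [||f + [f1 f0]] :=
    @C0_urysohn R X [set x] [set x'] lcX hsX (@compact_set1 X x).
  - apply: accessible_closed_set1; exact: hausdorff_accessible.
  - by apply/seteqP; split => // _ [-> /= /xx'].
  rewrite -FC0 => -[h _ hf].
  have /eqP : f x = f x' by rewrite -hf /pullback /= Fxx'.
  by rewrite f1// f0// oner_eq0.
apply: compact_preimage_proper => // K cK.
have [|h C0h [h1 _]] := @C0_urysohn R Y K set0 lcY hsY cK closed0.
  exact: setI0.
have [_ /(_ 1%R ltr01)[L cL Lh]] : C0 R X (pullback F h).
  by rewrite -FC0; exists h.
apply: (subclosed_compact _ cL).
  by apply: preimage_closed => [x _|]; [exact: ctsF|exact: compact_closed].
move=> x Kx; apply: contrapT => /Lh.
by rewrite /pullback /= h1// normr1 ltxx.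
Qed.
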